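(* Let $d\ge 4$ and let $m\in\{2d+1,\,2d+2\}$. Then $\gamma^d_m(K^d)=\frac{d-1}{d}$.
   Context: $K^d=\{(x_1,\ldots,x_d)\in\mathbb{R}^d : |x_1|+\cdots+|x_d|\le 1\}$ is the $d$-dimensional crosspolytope. For a convex body $K\subset\mathbb{R}^d$ with non-empty interior and a positive integer $m$, $$\gamma^d_m(K)=\min\Big\{\lambda>0 : \exists\, u_1,\ldots,u_m\in\mathbb{R}^d \text{ such that } K\subseteq\bigcup_{i=1}^m(\lambda K+u_i)\Big\},$$ i.e. the smallest positive $\lambda$ such that $K$ can be covered by $m$ translates of $\lambda K$. *)

(* Defs.v *)
From mathcomp Require Import all_boot all_order all_algebra.
From mathcomp Require Import all_classical all_reals.
Set Implicit Arguments.
Unset Strict Implicit.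
Unset Printing Implicit Defensive.
Import Order.TTheory GRing.Theory Num.Theory.
Local Open Scope classical_set_scope.
Local Open Scope ring_scope.

Definition crosspolytope (R : realType) (d : nat) : set 'rV[R]_d :=
  [set x | \sum_(i < d) `|x 0 i| <= 1].

Definition homothet (R : realType) (d : nat)
    (l : R) (K : set 'rV[R]_d) (u : 'rV[R]_d) : set 'rV[R]_d :=
  [set l *: y + u | y in K].

Definition covering_ratios (R : realType) (d : nat)
    (K : set 'rV[R]_d) (m : nat) : set R :=
  [set l | 0 < l /\ exists u : 'I_m -> 'rV[R]_d,
     K `<=` \bigcup_(i in [set: 'I_m]) homothet l K (u i)].

(* An attained minimum, not merely an infimum; the junk value 0 is returned
   when A has no least element. *)
Definition minimum (R : realType) (A : set R) : R :=
  xget 0 (A `&` lbound A).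

Lemma minimum_eq (R : realType) (A : set R) (x : R) :
  A x -> lbound A x -> minimum A = x.
Proof.
move=> Ax lx; apply: xget_unique; first by split.
by move=> y [Ay ly]; apply/le_anti; rewrite ly ?lx.
Qed.

(* Since 0 is never a covering ratio, gamma K m = c with c <> 0 says exactly
   that c is the least covering ratio. *)
Definition gamma (R : realType) (d : nat) (K : set 'rV[R]_d) (m : nat) : R :=
  minimum (covering_ratios K m).

Lemma gammaP (R : realType) (d : nat) (K : set 'rV[R]_d) (m : nat) (c : R) :
  c != 0 ->
  gamma K m = c <-> covering_ratios K m c /\ lbound (covering_ratios K m) c.
Proof.
move=> c0; split=> [|[]]; last exact: minimum_eq.
rewrite /gamma /minimum; case: xgetP => [x -> [Ax lx] <- //|_ c0E].
by rewrite -c0E eqxx in c0.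
Qed.

(* Main.v *)
Require Import Defs.
From mathcomp Require Import all_boot all_order all_algebra.
From mathcomp Require Import all_classical all_reals.
From mathcomp Require Import lra.
Set Implicit Arguments.
Unset Strict Implicit.
Unset Printing Implicit Defensive.
Import Order.TTheory GRing.Theory Num.Theory.
Local Open Scope classical_set_scope.
Local Open Scope ring_scope.

(** In the l1 norm, [crosspolytope] is the closed unit ball and a covering
    ratio is a radius [l] for which [m] closed balls of radius [l] cover it.

    Upper bound: the [2 * d] balls of radius [1 - 1/d] centred at the points
    [± e_i / d] suffice.  Given [x], move it by [1/d] towards [0] along its
    largest coordinate [x_i].  If [|x_i| >= 1/d] this shortens [x] by [1/d];
    otherwise all coordinates are below [1/d], so [x] is short enough to begin
    with that overshooting [0] in coordinate [i] does no harm
    ([crosspolytope_cover]).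

    Lower bound: let [l < 1 - 1/d], so that a ball of radius [l] contains no
    two points at distance [2 * (1 - 1/d)] or more.  The vertices [± e_i] are
    at mutual distance [2], hence occupy [2 * d] different balls.  The
    barycentre of a facet is at distance at least [2 * (1 - 1/d)] from every
    vertex ([l1_vertex_facet]), so the [2 ^ d] barycentres have to be covered
    by the remaining balls, of which there are at most two.  Barycentres whose
    sign vectors disagree in all coordinates, or in all but one, are again too
    far apart to share a ball ([l1_facet_facet]).  Thus the balls would
    properly colour with two colours the graph joining sign vectors at Hamming
    distance at least [d - 1].  This graph is not bipartite: [A] and [A] with
    one sign changed are both adjacent to the opposite of the latter, hence
    have the same colour, so that the colouring is constant
    ([two_colouring_near_complement]), whereas [A] and its opposite are
    adjacent. *)

(** * The l1 norm and its balls *)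

Section L1.
Variables (R : realType) (d : nat).
Implicit Types (x y u : 'rV[R]_d) (i j : 'I_d) (l : R).

Definition l1 x : R := \sum_(i < d) `|x 0 i|.

Lemma coordB x y i : (x - y) 0 i = x 0 i - y 0 i.
Proof. by rewrite !mxE. Qed.

Lemma l1_ge_coord2 x i j : i != j -> `|x 0 i| + `|x 0 j| <= l1 x.
Proof.
move=> ij; rewrite /l1 (bigD1 i) //= (bigD1 j) 1?eq_sym //= lerD2l lerDl.
exact: sumr_ge0.
Qed.

Lemma l1_ge_coord x i : `|x 0 i| <= l1 x.
Proof. by rewrite /l1 (bigD1 i) //= lerDl; exact: sumr_ge0. Qed.

Lemma sum_except_const i (a : R) : \sum_(j < d | j != i) a = (d%:R - 1) * a.
Proof.
have all_a : \sum_(j < d) a = d%:R * a by rewrite sumr_const card_ord mulr_natl.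
by rewrite mulrBl mul1r -all_a [X in _ = X - _](bigD1 i) //= addrC addrK.
Qed.

Lemma l1_ge_except x i (a b : R) : a <= `|x 0 i| ->
  (forall j, j != i -> b <= `|x 0 j|) -> a + (d%:R - 1) * b <= l1 x.
Proof.
move=> ai bj; rewrite /l1 (bigD1 i) //= lerD // -(sum_except_const i).
exact: ler_sum.
Qed.

Lemma homothet_crosspolytopeE l u x : 0 < l ->
  homothet l (@crosspolytope R d) u x <-> l1 (x - u) <= l.
Proof.
move=> l0.
have l1Z y : l1 (l *: y) = l * l1 y.
  by rewrite /l1 mulr_sumr; apply: eq_bigr => i _; rewrite mxE normrM gtr0_norm.
split=> [[y Ky <-]|xu].
  by rewrite addrK l1Z ler_piMr // ltW.
exists (l^-1 *: (x - u)); last by rewrite scalerA divff ?gt_eqF// scale1r subrK.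
rewrite /crosspolytope /= -/(l1 _) -(ler_pM2l l0) -l1Z scalerA.
by rewrite divff ?gt_eqF// scale1r mulr1.
Qed.

Lemma l1_ball_diameter l u x y :
  l1 (x - u) <= l -> l1 (y - u) <= l -> l1 (x - y) <= l *+ 2.
Proof.
move=> xu yu; apply: (@le_trans _ _ (l1 (x - u) + l1 (y - u))).
  rewrite /l1 -big_split /=; apply: ler_sum => i _; rewrite !mxE.
  by rewrite (distrC (y 0 i)) (le_trans _ (ler_normD _ _)) // addrA subrK.
by rewrite mulr2n lerD.
Qed.

(** A covering family may be indexed by any finite type with at most [m]
    elements: the superfluous balls are centred at [0]. *)
Lemma covering_ratio_family (T : finType) (c : T -> 'rV[R]_d) m l :
  0 < l -> (#|T| <= m)%N ->
  (forall x, l1 x <= 1 -> exists t, l1 (x - c t) <= l) ->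
  covering_ratios (@crosspolytope R d) m l.
Proof.
move=> l0 Tm cov; split=> //.
exists (fun k : 'I_m => nth 0 [seq c t | t <- enum T] k) => x /cov [t xt].
have tT : (index t (enum T) < size (enum T))%N by rewrite index_mem mem_enum.
have tm : (index t (enum T) < m)%N by rewrite (leq_trans tT) // -cardE.
exists (Ordinal tm) => //; apply/homothet_crosspolytopeE => //=.
by rewrite (nth_map t) // nth_index ?mem_enum.
Qed.

(** * Covering by two balls on each axis *)

Definition vertex (t : 'I_d * bool) : 'rV[R]_d :=
  (-1) ^+ t.2 *: delta_mx 0 t.1.

Lemma vertex_at i b : vertex (i, b) 0 i = (-1) ^+ b.
Proof. by rewrite !mxE !eqxx mulr1. Qed.

Lemma vertex_off i b j : j != i -> vertex (i, b) 0 j = 0.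
Proof. by move=> /negPf ji; rewrite !mxE ji andbF mulr0. Qed.

Lemma l1_vertex t : l1 (vertex t) = 1.
Proof.
case: t => i b; rewrite /l1 (bigD1 i) //= vertex_at normr_sign big1 ?addr0 //.
by move=> j ji; rewrite vertex_off ?normr0.
Qed.

(** The centre is taken on the axis of a largest coordinate of [x], on the
    side of [x]: this coordinate is at least the average of all of them, which
    is what makes the ball large enough when [x] is close to [0]. *)
Lemma crosspolytope_cover x : (1 < d)%N -> l1 x <= 1 ->
  exists t, l1 (x - d%:R^-1 *: vertex t) <= 1 - d%:R^-1.
Proof.
move=> d1 x1; have d0 : (0 < d)%N by exact: ltnW.
pose i := [arg max_(j > Ordinal d0) `|x 0 j|]%O.
have maxi j : `|x 0 j| <= `|x 0 i|.
  by rewrite /i; case: arg_maxP => //= k _ /(_ j); exact.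
have a0 : (0 : R) < d%:R^-1 by rewrite invr_gt0 ltr0n.
have da : d%:R * d%:R^-1 = 1 :> R by rewrite divff // pnatr_eq0 -lt0n.
have d2 : (2 : R) <= d%:R by rewrite (ler_nat R 2).
exists (i, x 0 i < 0); rewrite /l1 (bigD1 i) //=.
have -> : `|(x - d%:R^-1 *: vertex (i, x 0 i < 0)) 0 i|
          = `| `|x 0 i| - d%:R^-1|.
  rewrite 3!mxE vertex_at mulrC {1}[x 0 i]realEsign ?num_real // -mulrBr.
  by rewrite normrMsign.
have -> : \sum_(j < d | j != i) `|(x - d%:R^-1 *: vertex (i, x 0 i < 0)) 0 j|
          = \sum_(j < d | j != i) `|x 0 j|.
  by apply: eq_bigr => j ji; rewrite 3!mxE vertex_off // mulr0 subr0.
have rest : \sum_(j < d | j != i) `|x 0 j| <= (d%:R - 1) * `|x 0 i|.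
  by rewrite -(sum_except_const i); exact: ler_sum.
move: x1; rewrite /l1 (bigD1 i) //=.
move: (\sum_(j < d | _) _) `|x 0 i| (d%:R) (d%:R^-1) rest a0 da d2.
move=> S t D a rest a0 da d2 tS.
have [ta|/ltW ta] := lerP a t; first lra.
(* [S - t <= (D - 2) * t <= (D - 2) * a = 1 - 2 * a] *)
have : (D - 2) * t <= (D - 2) * a by apply: ler_wpM2l => //; rewrite subr_ge0.
lra.
Qed.

(** * Vertices and facet barycentres are far apart *)

Lemma l1_vertex_vertex s t : s != t -> 2 <= l1 (vertex s - vertex t).
Proof.
case: s t => [i b] [j c]; rewrite xpair_eqE.
have [<-|ij] := eqVneq i j => /= st.
  apply: le_trans (l1_ge_coord _ i); rewrite coordB !vertex_at.
  by move: st; case: b c => [] [] // _; rewrite ?expr0 ?expr1 ler_normr; lra.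
apply: le_trans (l1_ge_coord2 _ ij).
rewrite !mxE !eqxx (negPf ij) (eq_sym j) (negPf ij) !(mulr1, mulr0, subr0, sub0r).
by rewrite normrN !normr_sign; lra.
Qed.

(** The barycentre of the facet with sign vector [-1] on [A] and [1] off [A]. *)
Definition facet_center (A : {set 'I_d}) : 'rV[R]_d :=
  \row_i ((-1) ^+ (i \in A) / d%:R).

Lemma norm_facet_center A i : `|facet_center A 0 i| = d%:R^-1.
Proof. by rewrite mxE normrMsign ger0_norm // invr_ge0. Qed.

Lemma l1_facet_center A : l1 (facet_center A) <= 1.
Proof.
rewrite /l1 (eq_bigr _ (fun i _ => norm_facet_center A i)) sumr_const card_ord.
rewrite -[leLHS]mulr_natl; have [->|d0] := eqVneq (d%:R : R) 0; last by rewrite divff.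
by rewrite mul0r ler01.
Qed.

(** In the remaining coordinates the vertex vanishes, so that the signs of
    [A] are irrelevant there: the distance is large
    whether or not the vertex lies on the facet. *)
Lemma l1_vertex_facet t A : (1 - d%:R^-1) *+ 2 <= l1 (vertex t - facet_center A).
Proof.
case: t => i b.
have d0 : (d%:R : R) != 0 by rewrite pnatr_eq0 -lt0n (leq_ltn_trans _ (ltn_ord i)).
have -> : (1 - d%:R^-1) *+ 2 = (1 - d%:R^-1) + (d%:R - 1) * d%:R^-1 :> R.
  by rewrite mulrBl divff // mul1r mulr2n.
apply: (@l1_ge_except _ i) => [|j ji]; rewrite coordB.
  by rewrite (le_trans _ (lerB_dist _ _)) // vertex_at normr_sign norm_facet_center.
by rewrite vertex_off // sub0r normrN norm_facet_center.
Qed.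

(** The coordinate [i] is left free so that one statement serves both for
    opposite sign vectors and for those agreeing in a single coordinate. *)
Lemma l1_facet_facet (A B : {set 'I_d}) i : (forall j, j != i -> (j \in A) != (j \in B)) ->
  (1 - d%:R^-1) *+ 2 <= l1 (facet_center A - facet_center B).
Proof.
move=> AB.
have d0 : (d%:R : R) != 0 by rewrite pnatr_eq0 -lt0n (leq_ltn_trans _ (ltn_ord i)).
have -> : (1 - d%:R^-1) *+ 2 = 0 + (d%:R - 1) * (d%:R^-1 *+ 2) :> R.
  by rewrite add0r mulrnAr mulrBl divff // mul1r.
apply: (@l1_ge_except _ i) => // j /AB; rewrite !mxE -mulrBl.
case: (j \in A) (j \in B) => [] [] // _;
  rewrite ?expr0 ?expr1 normrM -[leLHS]mulr_natl (ger0_norm (x := _^-1)) ?invr_ge0 //;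
  by rewrite ler_wpM2r ?invr_ge0 // ler_normr; lra.
Qed.

End L1.

(** * Non-bipartiteness of the near-antipodal graph of the cube *)

(** [A] and [i |: A] are both forced to differ in colour from
    [~: (i |: A)], and there is only one other colour; adding elements one at a
    time then propagates the colour of the empty set to every set. *)
Lemma two_colouring_near_complement (n : nat) (T : finType) (C : {set T})
    (c : {set 'I_n} -> T) : (#|C| <= 2)%N -> (forall A, c A \in C) ->
  (forall A i, c A != c (~: (i |: A))) -> (forall A, c A != c (~: A)) ->
  False.
Proof.
move=> C2 cC cadj copp.
have cU A i : c (i |: A) = c A.
  apply/eqP; apply: contraLR C2 => ciA; rewrite -ltnNge; apply/card_gt2P.
  exists (c (i |: A)), (c A), (c (~: (i |: A))); split=> //.
  by split; rewrite // eq_sym copp.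
have c0 A : c A = c finset.set0.
  have [k] := ubnP #|A|; elim: k A => // k IH A Ak.
  have [->//|[i iA]] := set_0Vmem A.
  rewrite -(finset.setD1K iA) cU; apply: IH.
  by move: Ak; rewrite (cardsD1 i) iA add1n ltnS.
by have := copp finset.set0; rewrite [X in _ != X]c0 eqxx.
Qed.

(** * The two bounds *)

Lemma crosspolytope_covering_ratio (R : realType) (d m : nat) :
  (1 < d)%N -> (2 * d <= m)%N ->
  covering_ratios (@crosspolytope R d) m (1 - d%:R^-1).
Proof.
move=> d1 dm.
apply: (@covering_ratio_family _ _ _ (fun t => d%:R^-1 *: vertex R t)).
- by rewrite subr_gt0 invf_lt1 ?ltr1n ?ltr0n // ltnW.
- by rewrite card_prod card_ord card_bool mulnC.
- by move=> x; exact: crosspolytope_cover.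
Qed.

(** Each point of the polytope is assigned a ball [f] containing it; [f]
    separates points at distance at least [2 * (1 - 1/d)].  Restricted to the
    vertices it is injective, and on the barycentres it is a colouring by the
    balls not assigned to any vertex. *)
Lemma crosspolytope_covering_lbound (R : realType) (d m : nat) :
  (0 < d)%N -> (m <= 2 * d + 2)%N ->
  lbound (covering_ratios (@crosspolytope R d) m) (1 - d%:R^-1).
Proof.
move=> d0 md l [l0 [u cov]]; rewrite leNgt; apply/negP => ll.
have /choice[f fP] (x : 'rV[R]_d) :
    exists k : 'I_m, l1 x <= 1 -> l1 (x - u k) <= l.
  have [x1|x1] := boolP (l1 x <= 1).
    by have [k _ /(homothet_crosspolytopeE _ _ l0)] := cov x x1; exists k.
  (* a point outside the polytope still needs some index, so [m] must be > 0 *)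
  have K0 : @crosspolytope R d 0.
    by rewrite /crosspolytope /= big1 ?ler01 // => i _; rewrite mxE normr0.
  by have [k _ _] := cov 0 K0; exists k.
have sep (x y : 'rV[R]_d) : l1 x <= 1 -> l1 y <= 1 ->
    (1 - d%:R^-1) *+ 2 <= l1 (x - y) -> f x != f y.
  move=> /fP xf /fP yf xy; apply/eqP => fxy; rewrite -fxy in yf.
  have := le_trans xy (l1_ball_diameter xf yf).
  by rewrite lerMn2r /= leNgt ll.
pose g t := f (vertex R t).
have g_inj : injective g.
  move=> s t; apply: contra_eq => st; apply: sep; rewrite ?l1_vertex //.
  apply: le_trans (l1_vertex_vertex R st).
  by rewrite lerMn2r /= gerBl invr_ge0.
pose c A := f (facet_center R A).
have cC A : c A \in ~: [set g t | t in finset.setT]%SET.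
  rewrite inE; apply/imsetP => -[t _ /eqP]; apply/negP.
  rewrite eq_sym; apply: sep (l1_vertex_facet _ _ _); rewrite ?l1_vertex //.
  exact: l1_facet_center.
apply: (two_colouring_near_complement _ cC).
- rewrite cardsCs finset.setCK card_ord card_imset // cardsT card_prod card_ord.
  by rewrite card_bool leq_subLR mulnC.
- move=> A i; apply: sep; [exact: l1_facet_center..|].
  apply: (@l1_facet_facet _ _ _ _ i) => j ji.
  by rewrite !inE (negPf ji) /=; case: (j \in A).
- move=> A; apply: sep; [exact: l1_facet_center..|].
  apply: (@l1_facet_facet _ _ _ _ (Ordinal d0)) => j _.
  by rewrite inE; case: (j \in A).
Qed.

Theorem theorem3 (R : realType) (d m : nat) (hd : (4 <= d)%N)
    (hm : m = (2 * d + 1)%N \/ m = (2 * d + 2)%N) :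
  gamma (@crosspolytope R d) m = (d%:R - 1) / d%:R.
Proof.
have d1 : (1 < d)%N by apply: leq_trans hd.
have d0 : (0 < d)%N by exact: ltnW.
have [dm md] : (2 * d <= m)%N /\ (m <= 2 * d + 2)%N.
  by case: hm => ->; rewrite ?leq_addr ?leq_add2l.
rewrite mulrBl mul1r divff ?pnatr_eq0 -?lt0n //.
apply: minimum_eq; first exact: crosspolytope_covering_ratio.
exact: crosspolytope_covering_lbound.
Qed.
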